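(* For Lebesgue almost every pair $(\alpha,x)\in(0,1)\times[0,1)$, one has $$\sum_{n\in V_{\alpha,x}}\frac1n=\infty .$$
   Context: Let $X=\mathbb{R}/\mathbb{Z}=[0,1)$ with Lebesgue measure, and let $\alpha\in(0,1)$ be irrational (irrationality of $\alpha$ is always assumed; rational $\alpha$ form a null set). Let $I=[0,1/2]\subset X$ and $f(x)=\chi_I(x)-\chi_{X\setminus I}(x)$, so that $f=1$ on $I$ and $f=-1$ on $X\setminus I$. The cylinder flow is $T_\alpha:X\times\mathbb{Z}\to X\times\mathbb{Z}$, $T_\alpha(x,n)=(x+\alpha \bmod 1,\ n+f(x))$. Write $\pi_2(x,n)=n$ (the level), so $\pi_2(T_\alpha^n(x,0))=\sum_{i=0}^{n-1}f(x+i\alpha \bmod 1)$. The set of balanced times of $x$ is $V_{\alpha,x}=\{n\in\mathbb{Z}^+ : \pi_2(T_\alpha^n(x,0))=0\}$. *)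

(* Defs.v *)
From HB Require Import structures.
From mathcomp Require Import all_boot all_order all_algebra.
From mathcomp Require Import all_classical all_reals all_analysis.
Set Implicit Arguments.
Unset Strict Implicit.
Unset Printing Implicit Defensive.
Import Order.TTheory GRing.Theory Num.Theory.
Import numFieldNormedType.Exports.
Local Open Scope classical_set_scope.
Local Open Scope ring_scope.

(* The circle R/Z is represented by its fundamental domain [0, 1) inside R;
   the maps below are total on R, but only matter for points of circle R. *)
Definition circle (R : realType) : set R := `[0, 1[.

Definition mod1 (R : realType) (x : R) : R := x - (Num.floor x)%:~R.

Definition half_circle (R : realType) : set R := `[0, 2^-1].

Definition level_step (R : realType) (x : R) : int :=
  \1_(@half_circle R) x - \1_(@circle R `\` @half_circle R) x.

Definition cylinder_flow (R : realType) (alpha : R) (p : R * int) : R * int :=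
  (mod1 (p.1 + alpha), p.2 + level_step p.1).

Definition level (R : realType) (p : R * int) : int := p.2.

Definition balanced_times (R : realType) (alpha x : R) : set nat :=
  [set n : nat | (0 < n)%N /\
                 level (iter n (cylinder_flow alpha) (x, 0)) = 0].

(* Main.v *)
Require Import Defs.
From mathcomp Require Import all_boot all_order all_algebra.
From mathcomp Require Import all_classical all_reals all_analysis.
From mathcomp Require Import measurable_realfun zify ring lra.
Set Implicit Arguments.
Unset Strict Implicit.
Unset Printing Implicit Defensive.
Import Order.TTheory GRing.Theory Num.Theory.
Import numFieldNormedType.Exports.
Local Open Scope classical_set_scope.
Local Open Scope ring_scope.

(** Fix [alpha] and suppose that within any [2 ^ k] consecutive steps an orbit
    of the cylinder flow visits at most [r k] levels.  If the sum of the
    [1 / r k] diverges, then for almost every [x] the sum of [1 / n] over the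
    balanced times of [x] diverges.  Indeed let [B] be the set of [x] for which
    that sum is at most [C], follow an orbit for [N = 2 ^ K] steps, and let [A]
    be the set of times [n < N] at which it is above [B].  Consider the energy of [A]: the sum of
    [1 / (m - n)] over the pairs [n < m] of times in [A] at the same level.
    Seen from time [n], the later times at the same level are balanced times of
    a point of [B], so that the energy is at most [C * #|A|].  On the other
    hand, cut the time interval into blocks of length [2 ^ k]: since a block
    meets at most [r k] levels, the Cauchy-Schwarz inequality produces at least
    about [#|A| ^ 2 * 2 ^ k / (N * r k)] pairs in a common block and at a
    common level.  Such a pair has reciprocal distance more than [2 ^- k], and
    even the sum of the [2 ^- k] over all the [k] for which a given pair is in a
    common block is at most twice its reciprocal distance.  Hence, summing over
    [k < K] and dividing by [#|A|],
    [#|A| * \sum_k 1 / r k <= (4 * C + 2) * N] ([energy_le]).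
    As the mean of [#|A|] over [x] is [N * mu B], the measure of [B] times
    [\sum_(k < K) 1 / r k] is bounded uniformly in [K]
    ([bounded_section_le]).

    It remains to control the number of levels for most [alpha].  If [p / q] is
    a reduced fraction with [`|q * alpha - p| <= 1 / q], the Birkhoff sums of
    length [q] are bounded by an absolute constant ([denjoy_koksma]).  By
    Dirichlet's theorem [n = b * q + r] with such a [q <= n] and moreover
    [`|q * alpha - p| < 1 / n], whence [`|q * alpha - p| < 1 / (j * q)] for all
    [j <= b].  So the cost [b] of the [b] blocks of length [q] is at most the
    number of [j] such that [q * alpha] is [1 / (j * q)]-close to an integer,
    and by induction on [n] the Birkhoff sums of length [n] are bounded by the
    number of pairs [(q, j)], [q <= n], with this property
    ([birkhoff_le_resonance]).  For random [alpha] a pair has probability at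
    most [4 / (j * q)].  Discarding a set of small measure one may restrict to
    [j] at most a multiple of [k] when [n <= 2 ^ k], so the expected number of
    pairs is of order [k * log k], and by Markov's inequality [r k] is of that
    order outside a set of [alpha] of small measure, for each [k]
    ([good_set_measure]).  This is just enough: the sum of
    [1 / (k * log k)] diverges ([level_weight_divergent]).

    The set of good [alpha] depends on [k], so the two parts are combined by
    averaging over [alpha] as well: if the sections of measure at least [d] had
    positive total measure, the averages over these [alpha] of
    [\sum_(k < K) 1 / r k], restricted to the good [k], would stay bounded
    although each [k] is good for at least half of them
    ([heavy_sections_null]). *)

(** * Birkhoff sums along rational approximations *)

(** The indicator that the fractional part of [y] exceeds [1 / 2], as a
    difference of two monotone functions that commute with the unit
    translation; the ceiling makes the half circle closed at [1 / 2]. *)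
Definition upper_half (R : realType) (y : R) : int :=
  Num.ceil (y - 2^-1) - Num.floor y.

Definition birkhoff (R : realType) (alpha : R) (n : nat) (x : R) : int :=
  \sum_(i < n) (1 - 2 * upper_half (x + i%:R * alpha)).

Section DenjoyKoksma.
Variable R : realType.
Implicit Types (x y alpha : R) (n q : nat) (p : int).

Lemma upper_half_mod1 x : upper_half (mod1 x) = upper_half x.
Proof.
rewrite /upper_half /mod1 addrAC -rmorphN/= ceilDrz ?intr_int// floorDrz ?intr_int//.
by rewrite intrKceil intrKfloor subrr subr0.
Qed.

Lemma mod1_itv x : 0 <= mod1 x < 1.
Proof.
rewrite /mod1 subr_ge0 floor_le ltrBlDr.
by have := floorD1_gt x; rewrite intrD addrC.
Qed.

Lemma mod1_id x : 0 <= x < 1 -> mod1 x = x.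
Proof.
move=> x01; rewrite /mod1 (_ : Num.floor x = 0) ?subr0//.
by apply/eqP; rewrite floor_eq add0r.
Qed.

Lemma mod1D x y : mod1 (mod1 x + y) = mod1 (x + y).
Proof.
rewrite /mod1; set z := Num.floor x.
have -> : x - z%:~R + y = x + y + (- z)%:~R by rewrite rmorphN/= addrAC.
by rewrite floorDrz ?intr_int// intrKfloor intrD; ring.
Qed.

Lemma level_step_upper_half y : 0 <= y < 1 -> level_step y = 1 - 2 * upper_half y.
Proof.
move=> y01; rewrite /level_step /upper_half.
have -> : Num.floor y = 0 by apply/eqP; rewrite floor_eq add0r.
rewrite !indicE in_setD /half_circle /circle !mem_setE !in_itv/= y01.
have [y0 y1] := andP y01.
rewrite y0/=; case: (leP y 2^-1) => hy /=.
  rewrite (_ : Num.ceil _ = 0)//.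
  by apply/eqP; rewrite ceil_eq; apply/andP; split; lra.
rewrite (_ : Num.ceil _ = 1)//.
by apply/eqP; rewrite ceil_eq; apply/andP; split; lra.
Qed.

(** From here on the flow is replaced by sums over an arithmetic progression in
    the real line, without reduction modulo 1. *)
Lemma iter_cylinder_flow alpha x n : 0 <= x < 1 ->
  iter n (cylinder_flow alpha) (x, 0) =
  (mod1 (x + n%:R * alpha), birkhoff alpha n x).
Proof.
move=> x01; elim: n => [|n IH].
  by rewrite /= mul0r addr0 mod1_id// /birkhoff big_ord0.
rewrite iterS IH /cylinder_flow /= mod1D; congr pair.
  by congr mod1; rewrite -natr1; ring.
by rewrite /birkhoff big_ord_recr/= level_step_upper_half ?mod1_itv// upper_half_mod1.
Qed.

Lemma birkhoffD alpha m n x :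
  birkhoff alpha (m + n) x = birkhoff alpha m x + birkhoff alpha n (x + m%:R * alpha).
Proof.
rewrite /birkhoff big_split_ord/=; congr +%R; apply: eq_bigr => i _.
by congr (1 - 2 * upper_half _); rewrite natrD; ring.
Qed.

Lemma birkhoff_mod1 alpha n x : birkhoff alpha n (mod1 x) = birkhoff alpha n x.
Proof.
apply: eq_bigr => i _.
by rewrite -upper_half_mod1 mod1D upper_half_mod1.
Qed.

Section equivariant.
Variable g : R -> int.
Hypothesis g_nd : {homo g : x y / x <= y}.
Hypothesis g1 : forall x, g (x + 1) = g x + 1.

Lemma equivariantD x (z : int) : g (x + z%:~R) = g x + z.
Proof.
have gn y n : g (y + n%:R) = g y + n%:Z.
  elim: n => [|n IH]; first by rewrite !addr0.
  by rewrite -natr1 addrA g1 IH; lia.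
case: z => n; first exact: gn.
have := gn (x + (Negz n)%:~R) n.+1.
by rewrite NegzE rmorphN/= subrK => ->; lia.
Qed.

Definition grid_sum q x : int := \sum_(j < q) g (x + j%:R / q%:R).

Lemma le_grid_sum q x y : x <= y -> grid_sum q x <= grid_sum q y.
Proof. by move=> xy; apply: ler_sum => i _; apply: g_nd; rewrite lerD2r. Qed.

Lemma grid_sumS q x : (0 < q)%N -> grid_sum q (x + q%:R^-1) = grid_sum q x + 1.
Proof.
case: q => // q _; rewrite /grid_sum big_ord_recr [in RHS]big_ord_recl/=.
have -> : x + q.+1%:R^-1 + q%:R / q.+1%:R = x + 1.
  by rewrite -natr1; field; rewrite natr1 pnatr_eq0.
have -> : \sum_(i < q) g (x + q.+1%:R^-1 + i%:R / q.+1%:R) =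
          \sum_(i < q) g (x + (bump 0 i)%:R / q.+1%:R).
  by apply: eq_bigr => i _; rewrite /bump/= add1n -[in RHS]natr1 mulrDl mul1r addrAC addrA.
by rewrite g1 mul0r addr0; ring.
Qed.

Lemma grid_sumDn q x n : (0 < q)%N -> grid_sum q (x + n%:R / q%:R) = grid_sum q x + n%:Z.
Proof.
move=> q0; elim: n => [|n IH]; first by rewrite mul0r !addr0.
by rewrite -natr1 mulrDl mul1r addrA grid_sumS// IH; lia.
Qed.

(** Multiplication by [p] permutes the residues modulo [q]; the quotients only
    contribute an integer that depends neither on [x] nor on [g], which is what
    makes the comparison of two different [g] possible. *)
Lemma grid_sum_rat q p x : (0 < q)%N -> coprimez p q ->
  \sum_(i < q) g (x + i%:R * (p%:~R / q%:R)) =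
  \sum_(i < q) (i%:Z * p %/ q)%Z + grid_sum q x.
Proof.
move=> q0 cop.
have hP (i : 'I_q) : (`|(i%:Z * p %% q)%Z| < q)%N.
  by rewrite -ltz_nat gez0_abs ?modz_ge0 ?ltz_pmod//; lia.
pose h i := Ordinal (hP i).
have h_inj : injective h.
  move=> i j [] /(congr1 Posz); rewrite !gez0_abs ?modz_ge0//; try lia.
  move=> /eqP; rewrite eqz_mod_dvd -mulrBl Gauss_dvdzl; last by rewrite coprimez_sym.
  rewrite -eqz_mod_dvd => /eqP; rewrite !modz_small ?ltz_nat ?ltn_ord ?lez_nat//.
  by move=> -[] /val_inj.
rewrite /grid_sum [X in _ = _ + X](reindex_inj h_inj)/= -big_split/=; apply: eq_bigr => i _.
rewrite addrC -equivariantD; congr g; rewrite -addrA; congr +%R.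
have qn0 : q%:R != 0 :> R by rewrite pnatr_eq0; lia.
have hE : (h i)%:R = (i%:Z * p %% q)%Z%:~R :> R.
  by rewrite -[LHS]/(`|(i%:Z * p %% q)%Z|%:R) pmulrn gez0_abs// modz_ge0//; lia.
apply: (mulIf qn0); rewrite hE mulrDl mulrA !divfK// -[i%:R]/(i%:Z%:~R) -intrM.
by rewrite [in LHS](divz_eq (i%:Z * p) q) intrD intrM addrC.
Qed.

(** The first [q] points [x + i * alpha] are within [1 / q] of the points
    [x + i * p / q], and moving a whole grid of step [1 / q] by one step changes
    the sum of [g] by exactly 1. *)
Lemma orbit_grid_sum q p alpha x : (0 < q)%N -> coprimez p q ->
  `|q%:R * alpha - p%:~R| <= q%:R^-1 ->
  `|\sum_(i < q) g (x + i%:R * alpha)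
     - (\sum_(i < q) (i%:Z * p %/ q)%Z + grid_sum q x)| <= 1.
Proof.
move=> q0 cop hal.
have qp : 0 < q%:R :> R by rewrite ltr0n.
have qn0 : q%:R != 0 :> R by rewrite lt0r_neq0.
have close (i : 'I_q) : `|i%:R * alpha - i%:R * (p%:~R / q%:R)| <= q%:R^-1.
  have -> : i%:R * alpha - i%:R * (p%:~R / q%:R) =
      (i%:R / q%:R) * (q%:R * alpha - p%:~R) by field.
  rewrite normrM ger0_norm ?divr_ge0// -[leRHS]mul1r ler_pM// ?divr_ge0//.
  by rewrite ler_pdivrMr// mul1r ler_nat ltnW.
have lo : \sum_(i < q) g (x - q%:R^-1 + i%:R * (p%:~R / q%:R)) <=
          \sum_(i < q) g (x + i%:R * alpha).
  apply: ler_sum => i _; apply: g_nd.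
  by have := close i; rewrite ler_norml; lra.
have hi : \sum_(i < q) g (x + i%:R * alpha) <=
          \sum_(i < q) g (x + q%:R^-1 + i%:R * (p%:~R / q%:R)).
  apply: ler_sum => i _; apply: g_nd.
  by have := close i; rewrite ler_norml; lra.
move: lo hi; rewrite !grid_sum_rat// grid_sumS//.
have := grid_sumS (x - q%:R^-1) q0; rewrite subrK.
by lia.
Qed.

End equivariant.

Lemma floor_equivariant x : Num.floor (x + 1) = Num.floor x + 1 :> int.
Proof. by rewrite floorDrz ?rpred1// floor1. Qed.

Lemma ceil_equivariant x : Num.ceil (x + 1 - 2^-1) = Num.ceil (x - 2^-1) + 1 :> int.
Proof. by rewrite addrAC ceilDrz ?rpred1// ceil1. Qed.

(** Both the floor and the shifted ceiling sums over the orbit are, up to 1 and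
    to the same integer, sums over the regular grid of step [1 / q].  On the
    grid, a shift by [1 / 2] lies between [q./2] and [q./2.+1] steps, so that
    half of the points are in the upper half circle, up to a constant. *)
Lemma denjoy_koksma q p alpha x : (0 < q)%N -> coprimez p q ->
  `|q%:R * alpha - p%:~R| <= q%:R^-1 -> `|birkhoff alpha q x| <= 9.
Proof.
move=> q0 cop hal.
have qp : 0 < q%:R :> R by rewrite ltr0n.
have fl_nd : {homo (@Num.floor R) : x y / x <= y} by exact: le_floor.
have ce_nd : {homo (fun y : R => Num.ceil (y - 2^-1)) : x y / x <= y}.
  by move=> u v uv; apply: le_ceil; rewrite lerD2r.
have F := orbit_grid_sum fl_nd floor_equivariant x q0 cop hal.
have C := orbit_grid_sum ce_nd ceil_equivariant x q0 cop hal.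
set c := \sum_(i < q) (_ %/ _)%Z in F C.
pose G := grid_sum (@Num.floor R) q.
(* One grid step to the left makes the floor strictly smaller than the ceiling,
   also at integers. *)
have lo : G (x - 2^-1 - q%:R^-1) + q%:Z <=
          grid_sum (fun y : R => Num.ceil (y - 2^-1)) q x.
  have -> : q%:Z = \sum_(j < q) 1 by rewrite sumr_const card_ord; lia.
  rewrite /G /grid_sum -big_split/=; apply: ler_sum => j _.
  rewrite lezD1 floor_lt_int; apply: lt_le_trans (ceil_ge _).
  have : 0 < q%:R^-1 :> R by rewrite invr_gt0.
  lra.
have hi : grid_sum (fun y : R => Num.ceil (y - 2^-1)) q x <= G (x - 2^-1) + q%:Z.
  have -> : q%:Z = \sum_(j < q) 1 by rewrite sumr_const card_ord; lia.
  rewrite /G /grid_sum -big_split/=; apply: ler_sum => j _.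
  rewrite ceil_le_int; apply: ltW.
  by rewrite -addrA [_ / _ - _]addrC addrA floorD1_gt.
(* A shift by half a turn is a shift by [q./2] or [q./2.+1] grid steps. *)
have S1 := grid_sumS floor_equivariant (x - 2^-1 - q%:R^-1) q0.
rewrite subrK in S1.
have Sm := grid_sumDn floor_equivariant (x - q./2%:R / q%:R) q./2 q0.
rewrite subrK in Sm.
have Sm1 := grid_sumDn floor_equivariant (x - q./2.+1%:R / q%:R) q./2.+1 q0.
rewrite subrK in Sm1.
have qd := odd_double_half q.
have le1 : G (x - 2^-1) <= G (x - q./2%:R / q%:R).
  apply: le_grid_sum => //; rewrite lerD2l lerN2 ler_pdivrMr//.
  rewrite mulrC ler_pdivlMr// -natrM ler_nat; lia.
have le2 : G (x - q./2.+1%:R / q%:R) <= G (x - 2^-1).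
  apply: le_grid_sum => //; rewrite lerD2l lerN2 ler_pdivlMr//.
  rewrite mulrC ler_pdivrMr// -natrM ler_nat; lia.
have -> : birkhoff alpha q x = q%:Z
  - 2 * (\sum_(i < q) Num.ceil (x + i%:R * alpha - 2^-1)
         - \sum_(i < q) Num.floor (x + i%:R * alpha)).
  rewrite /birkhoff sumrB -mulr_sumr /upper_half sumrB; congr (_ - _).
  by rewrite sumr_const card_ord; lia.
rewrite -/G in S1 Sm Sm1 F.
by move: (odd q) qd => [] qd; lia.
Qed.

End DenjoyKoksma.

(** * Bounding Birkhoff sums by counting resonances *)

Section Discrepancy.
Variable R : realType.
Implicit Types (x y alpha e : R) (n q J : nat) (p : int).

Definition near_int e y : bool := `[< exists p, `|y - p%:~R| < e >].

(** For a given [q], the number of [j] that are counted plays the role of the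
    partial quotient following a convergent of denominator [q], truncated at
    [J]. *)
Definition resonance alpha J n : nat :=
  \sum_(1 <= q < n.+1) \sum_(1 <= j < J.+1)
    near_int (j * q)%:R^-1 (q%:R * alpha).

(** Pigeonhole on the fractional parts of [0], [alpha], ..., [n * alpha];
    dividing by the greatest common divisor only improves the approximation. *)
Lemma dirichlet alpha n : (0 < n)%N ->
  exists q p, [/\ (0 < q <= n)%N, coprimez p q & `|q%:R * alpha - p%:~R| < n%:R^-1].
Proof.
move=> n0.
have np : 0 < n%:R :> R by rewrite ltr0n.
have boxP (i : 'I_n.+1) : (Num.truncn (n%:R * mod1 (i%:R * alpha)) < n)%N.
  have /andP[m0 m1] := mod1_itv (i%:R * alpha).
  by rewrite truncn_lt_nat ?mulr_ge0// gtr_pMr.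
pose box i := Ordinal (boxP i).
have [/injectiveP inj|] := boolP (injectiveb box).
  by have := leq_card box inj; rewrite !card_ord ltnn.
case/injectivePn => i [j ij] [eqij].
wlog ltij : i j ij eqij / (i < j)%N.
  move=> H; case: (ltngtP i j) => ij'; first exact: (H i j).
    by apply: (H j i) => //; rewrite eq_sym.
  by move: ij; rewrite (val_inj ij') eqxx.
pose q := (j - i)%N.
pose p := Num.floor (j%:R * alpha) - Num.floor (i%:R * alpha).
have q0 : (0 < q)%N by rewrite subn_gt0.
have qn : (q <= n)%N by have := ltn_ord j; lia.
have hqp : `|q%:R * alpha - p%:~R| < n%:R^-1.
  have -> : q%:R * alpha - p%:~R = mod1 (j%:R * alpha) - mod1 (i%:R * alpha).
    by rewrite /mod1 natrB ?(ltnW ltij)// intrB; ring.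
  have box_itv (k : 'I_n.+1) : (box k)%:R <= n%:R * mod1 (k%:R * alpha) < (box k)%:R + 1.
    have /andP[m0 m1] := mod1_itv (k%:R * alpha).
    by rewrite natr1; apply: truncn_itv; rewrite mulr_ge0.
  have /andP[a1 a2] := box_itv i; have /andP[b1 b2] := box_itv j.
  rewrite -(ltr_pM2l np) mulfV ?lt0r_neq0// -[X in X * _](@ger0_norm _ n%:R)// -normrM.
  rewrite /= -eqij in b1 b2; rewrite mulrBr ltr_norml; apply/andP; split; lra.
pose d := gcdn `|p| q.
have d0 : (0 < d)%N by rewrite gcdn_gt0 q0 orbT.
have /dvdzP[p' pE] : (d%:Z %| p)%Z by exact: dvdn_gcdl.
have /dvdnP[q' qE] : (d %| q)%N by exact: dvdn_gcdr.
exists q', p'; split.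
- move: q0 qn; rewrite qE muln_gt0 => /andP[-> _] /=; apply: leq_trans.
  by rewrite leq_pmulr.
- have dE : gcdz p q = d%:Z by [].
  rewrite pE qE PoszM -mulz_gcdl in dE.
  have dn0 : d%:Z != 0 by rewrite eqz_nat -lt0n.
  by apply/eqP; apply: (mulIf dn0); rewrite mul1r.
- apply: le_lt_trans hqp.
  have -> : q%:R * alpha - p%:~R = d%:R * (q'%:R * alpha - p'%:~R).
    by rewrite qE pE natrM intrM -[d%:~R]/(d%:R); ring.
  by rewrite normrM ler_peMl// ger0_norm// -[1]/(1%:R) ler_nat.
Qed.

Lemma birkhoff_mul_le alpha q L : (forall x, `|birkhoff alpha q x| <= L) ->
  forall b x, `|birkhoff alpha (b * q) x| <= b%:Z * L.
Proof.
move=> H; elim=> [|b IH] x; first by rewrite mul0n mul0r /birkhoff big_ord0 normr0.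
rewrite mulSn birkhoffD; apply: le_trans (ler_normD _ _) _.
by have := H x; have := IH (x + q%:R * alpha); lia.
Qed.

(** Strong induction on [n]: write [n = b * q + r] with [q] given by Dirichlet's
    theorem.  The absence of very good approximations keeps [b] below [J], and
    the [b] pairs [(q, j)], [j <= b], are not counted in the resonances up to
    [r], since [r < q]. *)
Lemma birkhoff_le_resonance alpha J n x : (0 < J)%N ->
  (forall q, (0 < q <= n)%N -> ~~ near_int (J * q)%:R^-1 (q%:R * alpha)) ->
  `|birkhoff alpha n x| <= 9 * (resonance alpha J n)%:Z.
Proof.
move=> J0; elim/ltn_ind: n x => n IH x nonres.
have [->|n0] := posnP n; first by rewrite /birkhoff big_ord0 normr0.
have [q [p [/andP[q0 qn] cop hqp]]] := dirichlet alpha n0.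
have rq : (n %% q < q)%N by rewrite ltn_mod.
have close b : (0 < b)%N -> (b <= n %/ q)%N -> near_int (b * q)%:R^-1 (q%:R * alpha).
  move=> b0 bn; apply/asboolP; exists p; apply: lt_le_trans hqp _.
  rewrite lef_pV2 ?posrE ?ltr0n ?muln_gt0 ?b0// ler_nat.
  by apply: leq_trans (leq_trunc_div n q); rewrite leq_mul2r bn orbT.
(* With [J] blocks of length [q] or more, [q * alpha] would be
   [1 / (J * q)]-close to an integer. *)
have bJ : (n %/ q < J)%N.
  rewrite ltnNge; apply/negP => Jb.
  by have := nonres q; rewrite q0 qn => /(_ isT) /negP; apply; apply: close.
have Sq : forall y, `|birkhoff alpha q y| <= 9.
  move=> y; apply: (denjoy_koksma y q0 cop); apply: ltW; apply: lt_le_trans hqp _.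
  by rewrite lef_pV2 ?posrE ?ltr0n// ler_nat.
rewrite {1}(divn_eq n q) birkhoffD; apply: le_trans (ler_normD _ _) _.
have Sb := birkhoff_mul_le Sq (n %/ q) x.
have Sr : `|birkhoff alpha (n %% q) (x + (n %/ q * q)%:R * alpha)| <=
          9 * (resonance alpha J (n %% q))%:Z.
  apply: IH; first exact: leq_trans rq qn.
  move=> k /andP[k0 kr]; apply: nonres; rewrite k0/=.
  exact: leq_trans kr (leq_mod _ _).
have W : (resonance alpha J (n %% q) + n %/ q <= resonance alpha J n)%N.
  rewrite /resonance (@big_cat_nat _ _ _ (n %% q).+1 1 n.+1)//=; last first.
    by rewrite ltnS leq_mod.
  rewrite leq_add2l (@big_cat_nat _ _ _ q (n %% q).+1 n.+1)//=; last by rewrite ltnW.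
  apply: leq_trans (leq_addl _ _); rewrite big_ltn//; apply: leq_trans (leq_addr _ _).
  rewrite (@big_cat_nat _ _ _ (n %/ q).+1 1 J.+1)//=; last by rewrite ltnS ltnW.
  apply: leq_trans (leq_addr _ _).
  rewrite -[X in (X <= _)%N](_ : (\sum_(1 <= j < (n %/ q).+1) 1 = _)%N); last first.
    by rewrite sum_nat_const_nat muln1 subSS subn0.
  rewrite big_nat_cond [leqRHS]big_nat_cond; apply: leq_sum => j.
  by rewrite andbT => /andP[j0 jb]; rewrite close.
lia.
Qed.

Lemma leq_resonance alpha J m n : (m <= n)%N ->
  (resonance alpha J m <= resonance alpha J n)%N.
Proof.
move=> mn; rewrite /resonance [leqRHS](@big_cat_nat _ _ _ m.+1)//=.
exact: leq_addr.
Qed.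

End Discrepancy.

(** * The energy inequality *)

Section Energy.

(** Cauchy-Schwarz for the sizes of the fibres of [f]. *)
Lemma card_sqr_le_collisions (T U : finType) (f : T -> U) (A : {pred T}) :
  (#|A| ^ 2 <= #|U| * \sum_(a in A) \sum_(b in A) (f a == f b))%N.
Proof.
pose c u := (\sum_(a in A) (f a == u))%N.
have cA : (\sum_u c u = #|A|)%N.
  rewrite exchange_big/= -sum1_card; apply: eq_bigr => a _.
  rewrite (bigD1 (f a))//= eqxx big1 ?addn0// => u /negPf.
  by rewrite eq_sym => ->.
have cP : (\sum_u c u ^ 2 = \sum_(a in A) \sum_(b in A) (f a == f b))%N.
  under eq_bigr => u _.
    rewrite expnS expn1 /c big_distrlr/=; over.
  rewrite exchange_big/=; apply: eq_bigr => a _.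
  rewrite exchange_big/=; apply: eq_bigr => b _.
  rewrite (bigD1 (f a))//= eqxx mul1n eq_sym big1 ?addn0// => u /negPf.
  by rewrite eq_sym => ->.
rewrite -cA -cP -(leq_pmul2l (isT : 0 < 2)%N).
rewrite -[X in (2 * X)%N]mulnn big_distrlr/= big_distrr/=.
have -> : (2 * (#|U| * \sum_u c u ^ 2) = \sum_u \sum_v (c u ^ 2 + c v ^ 2))%N.
  under [RHS]eq_bigr => u _ do rewrite big_split/= sum_nat_const.
  by rewrite big_split/= sum_nat_const -big_distrr/= mul2n -addnn.
apply: leq_sum => u _; rewrite big_distrr/=; apply: leq_sum => v _.
exact: nat_Cauchy.
Qed.

Variable R : realFieldType.

Lemma sum_half_pow_le K : \sum_(k < K) (2 ^ k)%:R^-1 <= 2 :> R.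
Proof.
suff -> : \sum_(k < K) (2 ^ k)%:R^-1 = 2 - 2 * (2 ^ K)%:R^-1 :> R.
  by rewrite lerBlDr lerDl mulr_ge0.
elim: K => [|K IH]; first by rewrite big_ord0 expn0 invr1; ring.
rewrite big_ord_recr/= IH expnS natrM.
by field; rewrite natrX expf_neq0.
Qed.

(** The sum is dominated by its first term, which is less than [1 / d] because
    [d < 2 ^ k] there. *)
Lemma sum_half_pow_gt_le d K : (0 < d)%N ->
  \sum_(k < K | (d < 2 ^ k)%N) (2 ^ k)%:R^-1 <= 2 * d%:R^-1 :> R.
Proof.
move=> d0.
(* The induction needs the exact remainder [2 * 2 ^- K] of the geometric series,
   and the sum vanishes as long as [2 ^ K <= d]. *)
suff H : \sum_(k < K | (d < 2 ^ k)%N) (2 ^ k)%:R^-1 <=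
    Num.max 0 (2 * d%:R^-1 - 2 * (2 ^ K)%:R^-1) :> R.
  apply: le_trans H _; rewrite ge_max mulr_ge0//= lerBlDr lerDl mulr_ge0//.
elim: K => [|K IH]; first by rewrite big_ord0 le_max lexx.
have hK : (2 ^ K)%:R^-1 = 2 * (2 ^ K.+1)%:R^-1 :> R.
  by rewrite expnS natrM; field; rewrite natrX expf_neq0.
have hp : 0 <= (2 ^ K.+1)%:R^-1 :> R by [].
rewrite big_mkcond big_ord_recr/= -big_mkcond/=.
case: ifPn => [dK|_].
  have hd : (2 ^ K)%:R^-1 <= d%:R^-1 :> R.
    by rewrite lef_pV2 ?posrE ?ltr0n ?expn_gt0// ler_nat ltnW.
  rewrite le_max; apply/orP; right.
  by move: IH; rewrite max_r; [lra | lra].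
rewrite addr0; apply: le_trans IH _; rewrite ge_max !le_max lexx/=.
by apply/orP; right; lra.
Qed.

(** The reciprocal of a distance [d] is at least half of the sum of the [2 ^- k]
    over the [k] with [d < 2 ^ k], so the energy dominates a weighted count of
    the pairs in a common dyadic block at a common level.  For each admissible
    [k], such pairs are the collisions of the map sending a time to its block
    and to its level relative to the start of the block. *)
Lemma energy_le (K : nat) (s : nat -> int) (A : {pred 'I_(2 ^ K)}) (C : R)
    (T : pred nat) (L : nat -> nat) :
  (forall n : 'I_(2 ^ K), n \in A ->
     \sum_(m < 2 ^ K | [&& m \in A, (n < m)%N & s m == s n]) (m - n)%:R^-1 <= C) ->
  (forall k a l, T k -> (l < 2 ^ k)%N -> `|s (a + l)%N - s a| <= (L k)%:Z) ->
  #|A|%:R ^+ 2 * \sum_(k < K | T k) (2 * L k + 1)%:R^-1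
    <= #|A|%:R * (4 * C + 2) * (2 ^ K)%:R :> R.
Proof.
move=> hC hL.
have N0 : (0 < 2 ^ K)%N by rewrite expn_gt0.
pose block k n := (n %/ 2 ^ k)%N.
pose P k := (\sum_(n in A) \sum_(m in A) ((block k n == block k m) && (s n == s m)))%N.
have keyP k : T k -> (k < K)%N ->
    (#|A| ^ 2 <= 2 ^ (K - k) * (2 * L k + 1) * P k)%N.
  move=> Tk kK.
  have b1P (n : 'I_(2 ^ K)) : (block k n < 2 ^ (K - k))%N.
    by rewrite ltn_divLR ?expn_gt0// -expnD subnK// ltnW.
  (* The level relative to the start of the block, shifted by [L k] to make it
     nonnegative. *)
  pose off (n : nat) := (s n - s (block k n * 2 ^ k)%N + (L k)%:Z).
  have offP n : 0 <= off n <= 2 * (L k)%:Z.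
    have := hL k (block k n * 2 ^ k)%N (n %% 2 ^ k)%N Tk.
    rewrite ltn_mod expn_gt0 => /(_ isT); rewrite -divn_eq /off.
    by lia.
  have b2P (n : 'I_(2 ^ K)) : (`|off n| < 2 * L k + 1)%N.
    by have := offP n; lia.
  pose f n := (Ordinal (b1P n), Ordinal (b2P n)).
  have := card_sqr_le_collisions f A.
  rewrite card_prod !card_ord => /leq_trans; apply.
  rewrite leq_mul2l; apply/orP; right.
  apply: leq_sum => n _; apply: leq_sum => m _.
  case: (f n =P f m) => // -[e1 e2] /=.
  rewrite e1 eqxx/= lt0b; apply/eqP.
  by have := offP n; have := offP m; rewrite /off e1 in e2 *; lia.
pose w (n m : nat) : R := \sum_(k < K | block k n == block k m) (2 ^ k)%:R^-1.
have wP n m : (n < m)%N -> w n m <= 2 * (m - n)%:R^-1.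
  move=> nm; apply: le_trans (sum_half_pow_gt_le K _); last by rewrite subn_gt0.
  rewrite /w big_mkcond [leRHS]big_mkcond/=; apply: ler_sum => k _.
  case: eqP => [e|]; last by case: ifP.
  case: ifPn => //; rewrite -leqNgt => kd; exfalso.
  have := ltn_pmod m (expn_gt0 2 k : (0 < 2 ^ k)%N = true).
  have := divn_eq m (2 ^ k); have := divn_eq n (2 ^ k).
  move: e; rewrite /block => <-; lia.
have wC n m : w n m = w m n by apply: eq_bigl => k; rewrite eq_sym.
have sumP : \sum_(k < K | T k) (2 ^ k)%:R^-1 * (P k)%:R <=
    \sum_(n in A) \sum_(m in A | s n == s m) w n m.
  apply: le_trans (_ : \sum_(k < K) (2 ^ k)%:R^-1 * (P k)%:R <= _).
    by rewrite big_mkcond/=; apply: ler_sum => k _; case: ifP => // _; rewrite mulr_ge0.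
  rewrite le_eqVlt; apply/orP; left; apply/eqP.
  under eq_bigr => k _.
    rewrite natr_sum mulr_sumr.
    under eq_bigr => n _ do rewrite natr_sum mulr_sumr.
    over.
  rewrite exchange_big/=; apply: eq_bigr => n _.
  rewrite exchange_big/= [RHS]big_mkcondr/=; apply: eq_bigr => m _.
  case: (s n =P s m) => _; last by rewrite big1// => k _; rewrite andbF mulr0.
  rewrite /w [RHS]big_mkcond/=; apply: eq_bigr => k _.
  by rewrite andbT; case: eqP => _; rewrite ?mulr1 ?mulr0.
(* Diagonal pairs have no reciprocal distance; they contribute a geometric
   series, hence the 2 in the final bound. *)
have split_w (n m : 'I_(2 ^ K)) :
    w n m <= (if m == n then 2 else 0) + (if (n < m)%N then 2 * (m - n)%:R^-1 else 0)
             + (if (m < n)%N then 2 * (n - m)%:R^-1 else 0).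
  rewrite -val_eqE/=; case: (ltngtP n m) => nm /=.
  - by rewrite add0r addr0 wP.
  - by rewrite !add0r wC wP.
  - rewrite !addr0 nm /w; apply: le_trans (sum_half_pow_le K).
    by rewrite big_mkcond/=; apply: ler_sum => k _; case: ifP.
pose Z := \sum_(n in A) \sum_(m < 2 ^ K | [&& m \in A, (n < m)%N & s m == s n])
   (m - n)%:R^-1 : R.
have ZC : Z <= #|A|%:R * C.
  rewrite /Z -sum1_card natr_sum mulr_suml; apply: ler_sum => n nA.
  by rewrite mul1r hC.
have main : \sum_(n in A) \sum_(m in A | s n == s m) w n m <= 2 * #|A|%:R + 4 * Z.
  apply: le_trans (_ : \sum_(n in A) \sum_(m in A | s n == s m)
     ((if m == n then 2 else 0) + (if (n < m)%N then 2 * (m - n)%:R^-1 else 0)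
             + (if (m < n)%N then 2 * (n - m)%:R^-1 else 0)) <= _).
    by apply: ler_sum => n _; apply: ler_sum => m _.
  under eq_bigr => n nA do rewrite !big_split/=.
  rewrite !big_split/= (_ : 2 * _ + _ = 2 * #|A|%:R + 2 * Z + 2 * Z); last by ring.
  apply: lerD; first apply: lerD.
  - rewrite -sum1_card natr_sum mulr_sumr; apply: ler_sum => n nA.
    rewrite (bigD1 n) ?nA ?eqxx//= big1 ?addr0 ?mulr1// => m /andP[_ /negPf->] //.
  - rewrite /Z mulr_sumr; apply: ler_sum => n _.
    rewrite mulr_sumr -big_mkcondr/= le_eqVlt; apply/orP; left; apply/eqP.
    by apply: eq_bigl => m; rewrite -andbA [(_ < _)%N && _]andbC [s m == _]eq_sym.
  - rewrite (exchange_big_dep (mem A))/=; last by move=> ? ? _ /andP[].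
    rewrite /Z mulr_sumr; apply: ler_sum => n nA.
    rewrite mulr_sumr -big_mkcondr/= le_eqVlt; apply/orP; left; apply/eqP.
    by apply: eq_bigl => m; rewrite nA; case: (m \in A); rewrite //= andbC.
have key k : T k -> (k < K)%N ->
  #|A|%:R ^+ 2 * (2 * L k + 1)%:R^-1 <= (2 ^ K)%:R * ((2 ^ k)%:R^-1 * (P k)%:R) :> R.
  move=> Tk kK; have := keyP k Tk kK; rewrite -(ler_nat R) natrX => h.
  have KE : (2 ^ K)%:R = (2 ^ (K - k))%:R * (2 ^ k)%:R :> R.
    by rewrite -natrM -expnD subnK// ltnW.
  have k0 : (2 ^ k)%:R != 0 :> R by rewrite natrX expf_neq0.
  rewrite ler_pdivrMr ?ltr0n; last by rewrite addn1.
  apply: le_trans h _; rewrite natrM [in leLHS]natrM KE le_eqVlt.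
  by apply/orP; left; apply/eqP; field.
rewrite mulr_sumr; apply: le_trans (_ : \sum_(k < K | T k) (2 ^ K)%:R * ((2 ^ k)%:R^-1 * (P k)%:R) <= _).
  by apply: ler_sum => k Tk; apply: key.
rewrite -mulr_sumr mulrC; apply: ler_wpM2r => //.
apply: le_trans sumP _; apply: le_trans main _; lra.
Qed.

End Energy.

(** * Rotation invariance and averaging *)

Section Measure.
Variable R : realType.
Local Notation mu := (@lebesgue_measure R).

Lemma measurable_translate (a : R) :
  measurable_fun setT (fun x : measurableTypeR R => x + a : measurableTypeR R).
Proof. exact: measurable_funD. Qed.

Lemma lebesgue_measure_translate (a : R) (B : set R) : measurable B ->
  mu [set x | B (x + a)] = mu B.
Proof.
move=> mB; have mt := measurable_translate a.
rewrite -[LHS]/(pushforward mu (fun x : R => x + a : measurableTypeR R) B).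
apply/esym/lebesgue_measure_unique => //= _ [[u v]] _ <-.
rewrite /pushforward (_ : _ @^-1` _ = `]u - a, v - a]%classic); last first.
  by apply/seteqP; split => x /=; rewrite !in_itv/= ltrBlDr lerBrDr.
rewrite !lebesgue_measure_itv/= !lte_fin ltrD2r.
by case: ifP => // _; rewrite -!EFinB; congr EFin; ring.
Qed.

Lemma measurable_circle : measurable (@circle R).
Proof. exact: measurable_itv. Qed.

Lemma lebesgue_measure_circle : mu (@circle R) = 1%E.
Proof. by rewrite /circle lebesgue_measure_itv/= lte_fin ltr01 oppr0 adde0. Qed.

(** A rotation of the circle is a translation on each of the two arcs into
    which the point sent to 0 cuts it. *)
Lemma lebesgue_measure_rotation (a : R) (B : set R) : measurable B ->
  B `<=` @circle R -> mu (@circle R `&` [set x | B (mod1 (x + a))]) = mu B.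
Proof.
move=> mB Bc.
have [t [/andP[t0 t1] modt]] : exists t : R, 0 <= t < 1 /\ forall x, mod1 (x + a) = mod1 (x + t).
  by exists (mod1 a); rewrite mod1_itv; split=> // x; rewrite [x + mod1 a]addrC mod1D addrC.
have mI (u v : R) : measurable (B `&` `[u, v[%classic).
  by apply: measurableI => //; exact: measurable_itv.
have mT b (X : set R) : measurable X -> measurable [set x : R | X (x + b)].
  by move=> mX; rewrite -[X in measurable X]setTI; exact: measurable_translate.
have modE (x : R) : 0 <= x < 1 ->
    mod1 (x + a) = if x + t < 1 then x + t else x + (t - 1).
  move=> /andP[x0 x1]; rewrite modt; case: ifPn => [xt|].
    by rewrite mod1_id// addr_ge0.
  rewrite -leNgt => xt; rewrite addrA /mod1 (_ : Num.floor (x + t) = 1)//.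
  by apply/eqP; rewrite floor_eq xt/=; rewrite -[(1 + 1)%:~R]/(2 : R); lra.
have -> : @circle R `&` [set x | B (mod1 (x + a))] =
  [set x | (B `&` `[t, 1[%classic) (x + t)] `|`
  [set x | (B `&` `[0, t[%classic) (x + (t - 1))].
  apply/seteqP; split => [x [/= xc]|x /= []].
  - move: (xc); rewrite /circle/= in_itv/= => x01; rewrite modE//.
    rewrite !in_itv/=.
    case: ifPn => [xt Bx|]; first by left; split=> //; apply/andP; split; lra.
    by rewrite -leNgt => xt Bx; right; split=> //; apply/andP; split; lra.
  - rewrite /circle/= !in_itv/= => -[Bx /andP[h1 h2]].
    have x01 : 0 <= x < 1 by apply/andP; split; lra.
    by split=> //; rewrite modE// h2.
  - rewrite /circle/= !in_itv/= => -[Bx /andP[h1 h2]].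
    have x01 : 0 <= x < 1 by apply/andP; split; lra.
    by split=> //; rewrite modE// ifN// -leNgt; lra.
etransitivity.
  apply: measureU; [exact: mT|exact: mT|].
  by rewrite -subset0 => x /= []; rewrite !in_itv/= => -[_ /andP[_ h]] [_ /andP[h' _]]; lra.
transitivity (mu (B `&` `[t, 1%R[%classic) + mu (B `&` `[0%R, t[%classic))%E.
  by congr (_ + _)%E; exact: lebesgue_measure_translate.
etransitivity.
  apply/esym; apply: measureU; [exact: mI|exact: mI|].
  by rewrite -subset0 => x /= []; rewrite !in_itv/= => -[_ /andP[h _]] [_ /andP[_ h']]; lra.
congr (mu _); rewrite -setIUr; apply/seteqP; split=> [x []//|x Bx]; split=> //=.
rewrite !in_itv/=; have := Bc _ Bx; rewrite /circle/= in_itv/= => /andP[x0 x1].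
by rewrite x0 x1 /= andbT; case: (leP t x) => _; [left|right].
Qed.

End Measure.

Section Averaging.
Context d (T : measurableType d) (R : realType) (mu : {measure set T -> \bar R}).
Context (I : Type) (r : seq I) (c : I -> R) (G : I -> set T) (A : set T).
Hypothesis mA : measurable A.
Hypothesis mG : forall i, measurable (G i).
Hypothesis c0 : forall i, 0 <= c i.

Let integral_sum_indic :
  (\int[mu]_(x in A) (\sum_(i <- r) c i * \1_(G i) x)%:E =
   \sum_(i <- r) (c i)%:E * mu (G i `&` A))%E.
Proof.
under eq_integral => x _ do rewrite -sumEFin.
rewrite ge0_integral_sum//; first last.
- by move=> i x _; rewrite lee_fin mulr_ge0.
- move=> i; apply/measurable_EFinP; apply: measurable_funM => //.
apply: eq_bigr => i _; under eq_integral => x _ do rewrite EFinM.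
rewrite ge0_integralZl//; [by rewrite integral_indic|exact/measurable_EFinP|].
by rewrite lee_fin.
Qed.

Let measurable_sum_indic : measurable_fun A
  (fun x => (\sum_(i <- r) c i * \1_(G i) x)%:E).
Proof.
by apply/measurable_EFinP; apply: measurable_sum => i; apply: measurable_funM.
Qed.

Lemma sum_measure_le (M : R) : 0 <= M ->
  (forall x, A x -> \sum_(i <- r) c i * \1_(G i) x <= M) ->
  (\sum_(i <- r) (c i)%:E * mu (G i `&` A) <= M%:E * mu A)%E.
Proof.
move=> M0 H; rewrite -integral_sum_indic -integral_cst//.
apply: ge0_le_integral => // x Ax; rewrite lee_fin ?H//.
by rewrite sumr_ge0// => i _; rewrite mulr_ge0.
Qed.

Lemma le_sum_measure (M : R) : 0 <= M ->
  (forall x, A x -> M <= \sum_(i <- r) c i * \1_(G i) x) ->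
  (M%:E * mu A <= \sum_(i <- r) (c i)%:E * mu (G i `&` A))%E.
Proof.
move=> M0 H; rewrite -integral_sum_indic -integral_cst//.
by apply: ge0_le_integral => // x Ax; rewrite lee_fin// H.
Qed.

End Averaging.

Section Markov.
Context d (T : measurableType d) (R : realType) (mu : {measure set T -> \bar R}).
Context (I : Type) (r : seq I) (G : I -> set T) (A : set T).
Hypothesis mA : measurable A.
Hypothesis mG : forall i, measurable (G i).

Definition overlap (x : T) : R := \sum_(i <- r) \1_(G i) x.

Lemma measurable_overlap_ge (M : R) : measurable [set x | M <= overlap x].
Proof.
have mf : measurable_fun setT overlap.
  by apply: measurable_sum => i; exact: measurable_indic.
have -> : [set x | M <= overlap x] = overlap @^-1` `[M, +oo[%classic.
  by apply/seteqP; split=> x /=; rewrite in_itv/= andbT.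
by rewrite -[X in measurable X]setTI; apply: mf => //; exact: measurable_itv.
Qed.

(** Markov's inequality. *)
Lemma measure_overlap_ge (M b : R) : 0 < M ->
  (\sum_(i <- r) mu (G i `&` A) <= b%:E)%E ->
  (mu (A `&` [set x | (M <= overlap x)%R]) <= (b / M)%:E)%E.
Proof.
move=> M0 hb; rewrite EFinM lee_pdivlMr// muleC.
have mAM : measurable (A `&` [set x | M <= overlap x]).
  by apply: measurableI => //; exact: measurable_overlap_ge.
have := @le_sum_measure _ _ _ mu _ r (fun=> 1) G _ mAM mG (fun=> ler01) M (ltW M0).
move=> /(_ _)/le_trans; apply.
  move=> x [_ /=]; rewrite /overlap => /le_trans; apply.
  by under [leRHS]eq_bigr do rewrite mul1r.
apply: le_trans hb; apply: lee_sum => i _; rewrite mul1e.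
by apply: le_measure; rewrite ?inE; [exact: measurableI|exact: measurableI|move=> x []? []].
Qed.

End Markov.

(** * The divergent series of the weights *)

Section Harmonic.
Variable R : realType.

Definition harmonic_sum n : R := \sum_(1 <= j < n.+1) j%:R^-1.

Lemma harmonic_sum_ge0 n : 0 <= harmonic_sum n.
Proof. by apply: sumr_ge0. Qed.

Lemma harmonic_sum_gt0 n : (0 < n)%N -> 0 < harmonic_sum n.
Proof.
move=> n0; rewrite /harmonic_sum big_ltn// invr1 ltr_pwDl// sumr_ge0//.
Qed.

Lemma le_harmonic_sum m n : (m <= n)%N -> harmonic_sum m <= harmonic_sum n.
Proof.
move=> mn; rewrite /harmonic_sum [leRHS](@big_cat_nat _ _ _ m.+1)//=.
by rewrite lerDl sumr_ge0.
Qed.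

Lemma harmonic_sum_pow2S k : harmonic_sum (2 ^ k) + 2^-1 <= harmonic_sum (2 ^ k.+1)
  /\ harmonic_sum (2 ^ k.+1) <= harmonic_sum (2 ^ k) + 1.
Proof.
have k0 : (0 < 2 ^ k)%N by rewrite expn_gt0.
have kS : (2 ^ k <= 2 ^ k.+1)%N by rewrite leq_exp2l.
have -> : harmonic_sum (2 ^ k.+1) = harmonic_sum (2 ^ k) +
    \sum_((2 ^ k).+1 <= j < (2 ^ k.+1).+1) j%:R^-1.
  by rewrite /harmonic_sum (@big_cat_nat _ _ _ (2 ^ k).+1).
have cardE (x : R) : \sum_((2 ^ k).+1 <= j < (2 ^ k.+1).+1) x = (2 ^ k)%:R * x.
  by rewrite sumr_const_nat subSS expnS mul2n -addnn addnK mulr_natl.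
have kn0 : (2 ^ k)%:R != 0 :> R by rewrite pnatr_eq0 -lt0n.
split; rewrite lerD2l.
- have -> : 2^-1 = \sum_((2 ^ k).+1 <= j < (2 ^ k.+1).+1) (2 ^ k.+1)%:R^-1 :> R.
    by rewrite cardE expnS natrM; field.
  rewrite big_nat_cond [leRHS]big_nat_cond; apply: ler_sum => j.
  rewrite andbT => /andP[j0 j1]; rewrite lef_pV2 ?posrE ?ltr0n ?expn_gt0 ?ler_nat//.
  exact: leq_ltn_trans (leq0n _) j0.
- rewrite [leRHS](_ : _ = \sum_((2 ^ k).+1 <= j < (2 ^ k.+1).+1) (2 ^ k)%:R^-1); last first.
    by rewrite cardE mulfV.
  rewrite big_nat_cond [leRHS]big_nat_cond; apply: ler_sum => j.
  rewrite andbT => /andP[j0 j1]; rewrite lef_pV2 ?posrE ?ltr0n ?expn_gt0 ?ler_nat//; first exact: ltnW.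
  exact: leq_ltn_trans (leq0n _) j0.
Qed.

Lemma harmonic_sum_pow2_le k : harmonic_sum (2 ^ k) <= k.+1%:R.
Proof.
elim: k => [|k IH]; first by rewrite /harmonic_sum expn0 big_nat1 invr1.
by have [_ h] := harmonic_sum_pow2S k; rewrite -natr1; lra.
Qed.

Lemma harmonic_sum_pow2_ge k : k%:R / 2 <= harmonic_sum (2 ^ k).
Proof.
elim: k => [|k IH]; first by rewrite mul0r harmonic_sum_ge0.
by have [h _] := harmonic_sum_pow2S k; rewrite -natr1; lra.
Qed.

(** A lower bound for the reciprocal of the number of levels visited in
    [2 ^ k] steps, for [alpha] in [good_set c k]; of order [1 / (k * log k)].
    The factor 18 is twice the constant of [denjoy_koksma]. *)
Definition level_weight (c k : nat) : R :=
  (18 * (c * k.+1)%:R * harmonic_sum (c * k.+1) + 1)^-1.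

Lemma level_weight_ge0 c k : 0 <= level_weight c k.
Proof. by rewrite invr_ge0 addr_ge0// mulr_ge0// harmonic_sum_ge0. Qed.

(** On the block [2 ^ i <= k < 2 ^ i.+1] the weights are at least a constant
    times [2 ^- i / (i + 1)], so that the blocks compare to the harmonic
    series. *)
Lemma level_weight_divergent c (M : R) : (0 < c)%N ->
  exists K, M <= \sum_(k < K) level_weight c k.
Proof.
move=> c0.
(* The constant is generous: [c * k.+1 <= 2 ^ (c + i.+1)] on the block, so the
   harmonic sum in the weight is at most [c + i + 2 <= c.+2 * i.+1]; then
   [36 + 1 = 37] absorbs the summand 1. *)
pose b : R := (37 * c * c.+2)%:R.
have b0 : 0 < b by rewrite ltr0n !muln_gt0 c0.
have lw i k : (k < 2 ^ i.+1)%N -> (2 ^ i)%:R^-1 * (b^-1 * i.+1%:R^-1) <= level_weight c k.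
  move=> ki.
  have lhs0 : 0 < (2 ^ i)%:R * (b * i.+1%:R).
    by apply: mulr_gt0; [rewrite ltr0n expn_gt0|apply: mulr_gt0].
  have rhs0 : 0 < 18 * (c * k.+1)%:R * harmonic_sum (c * k.+1) + 1.
    by rewrite ltr_wpDl// mulr_ge0// harmonic_sum_ge0.
  rewrite /level_weight -!invfM lef_pV2 ?posrE//.
  have cJ : (c * k.+1 <= 2 ^ (c + i.+1))%N.
    by rewrite expnD leq_mul// ltnW// ltn_expl.
  have hJ : harmonic_sum (c * k.+1) <= (c + i.+1).+1%:R.
    by apply: le_trans (harmonic_sum_pow2_le _); exact: le_harmonic_sum.
  apply: (@le_trans _ _ (18 * (c * 2 ^ i.+1)%:R * (c + i.+1).+1%:R + 1)).
    rewrite lerD2r ler_pM ?mulr_ge0 ?harmonic_sum_ge0//.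
    by rewrite ler_pM2l// ler_nat leq_mul.
  rewrite /b -[18]/(18%:R) -[1 in leLHS]/(1%:R) -!natrM -natrD ler_nat.
  have : (0 < 2 ^ i)%N by rewrite expn_gt0.
  rewrite expnS; move: (2 ^ i)%N => t t0; clear -t0 c0.
  have h1 : ((c + i.+1).+1 <= c.+2 * i.+1)%N by nia.
  have h2 : (1 <= c * t * (c.+2 * i.+1))%N by rewrite !muln_gt0 c0 t0.
  have h3 : (c * t * (c + i.+1).+1 <= c * t * (c.+2 * i.+1))%N by rewrite leq_mul2l h1 orbT.
  have -> : (18 * (c * (2 * t)) * (c + i.+1).+1 = 36 * (c * t * (c + i.+1).+1))%N by ring.
  have -> : (t * (37 * c * c.+2 * i.+1) = 37 * (c * t * (c.+2 * i.+1)))%N by ring.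
  by move: h2 h3; lia.
have blocks n : b^-1 * harmonic_sum n <= \sum_(0 <= k < 2 ^ n) level_weight c k.
  elim: n => [|n IH].
    by rewrite /harmonic_sum big_geq// mulr0 sumr_ge0// => *; exact: level_weight_ge0.
  rewrite (@big_cat_nat _ _ _ (2 ^ n))//=; last by rewrite leq_exp2l.
  rewrite /harmonic_sum big_nat_recr//= mulrDr; apply: lerD => //.
  have -> : b^-1 * n.+1%:R^-1 =
      \sum_(2 ^ n <= k < 2 ^ n.+1) (2 ^ n)%:R^-1 * (b^-1 * n.+1%:R^-1).
    rewrite sumr_const_nat expnS mul2n -addnn addnK -[RHS]mulr_natl mulVKf//.
  by apply: ler_sum_nat => k /andP[_ h]; exact: lw.
pose m := (Num.truncn (2 * (b * M))).+1.
exists (2 ^ (2 ^ m))%N; rewrite -(big_mkord xpredT); apply: le_trans (blocks _).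
rewrite -(ler_pM2l b0) mulVKf ?lt0r_neq0//; apply: le_trans (harmonic_sum_pow2_ge m).
rewrite ler_pdivlMr// mulrC; apply: ltW; exact: truncnS_gt.
Qed.

End Harmonic.

(** * Rotation numbers with few resonances *)

Section Resonance.
Variable R : realType.
Local Notation mu := (@lebesgue_measure R).

Definition near_set (q : nat) (e : R) : set R := [set alpha | near_int e (q%:R * alpha)].

Lemma measurable_near_set q e : measurable (near_set q e).
Proof.
have -> : near_set q e = (fun x => q%:R * x) @^-1` \bigcup_(p : int) ball (p%:~R : R) e.
  apply/seteqP; split => [x /asboolP[p hp]|x [p _ hp]]; first by exists p; rewrite // /ball/= distrC.
  by apply/asboolP; exists p; rewrite distrC.
rewrite -[X in measurable X]setTI; apply: mulrl_measurable => //.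
by apply: open_measurable; apply: bigcup_open => p _; exact: ball_open.
Qed.

(** For [alpha] in the circle only [p <= q] can be close to [q * alpha]: the set
    is covered by [q + 1] intervals of length [2 * e / q]. *)
Lemma near_set_measure q e : (0 < q)%N -> 0 < e -> e <= 1 ->
  (mu (near_set q e `&` @circle R) <= (4 * e)%:E)%E.
Proof.
move=> q0 e0 e1; have mA : measurable (near_set q e `&` @circle R).
  by apply: measurableI; [exact: measurable_near_set|exact: measurable_circle].
have qp : 0 < q%:R :> R by rewrite ltr0n.
pose G (p : 'I_q.+1) : set R := `](p%:R - e) / q%:R, (p%:R + e) / q%:R[%classic.
have mG p : measurable (G p) by exact: measurable_itv.
have := @le_sum_measure _ _ _ mu _ (index_enum 'I_q.+1) (fun=> 1) G _ mA mG (fun=> ler01) 1 ler01.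
move=> /(_ _)/le_trans; rewrite mul1e; apply.
  move=> x [/asboolP[p hp]]; rewrite /circle/= in_itv/= => /andP[x0 x1].
  have qx0 : 0 <= q%:R * x by rewrite mulr_ge0.
  have qx1 : q%:R * x < q%:R by rewrite gtr_pMr.
  move: hp; rewrite ltr_norml => /andP[h1 h2].
  have p0 : 0 <= p by rewrite -ltzD1 -(ltr_int R) intrD; lra.
  have pq : p <= q%:Z.
    by rewrite -ltzD1 -(ltr_int R) intrD -[q%:Z%:~R]/(q%:R); lra.
  have pP : (`|p| < q.+1)%N by lia.
  have pE : (Ordinal pP)%:R = p%:~R :> R by rewrite /= pmulrn gez0_abs.
  rewrite (bigD1 (Ordinal pP))//= mul1r indicE mem_set ?lerDl; last first.
    rewrite /G/= in_itv/= [_%:R]pE ltr_pdivrMr// ltr_pdivlMr//.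
    by apply/andP; split; lra.
  by apply: sumr_ge0 => i _; rewrite mul1r.
apply: le_trans (_ : \sum_(p < q.+1) ((2 * e) / q%:R)%:E <= _)%E.
  apply: lee_sum => p _; rewrite mul1e.
  apply: le_trans (_ : mu (G p) <= _)%E.
    apply: le_measure; rewrite ?inE//; first by apply: measurableI; [exact: mG|exact: mA].
    exact: mG.
  rewrite lebesgue_measure_itv/= lte_fin; case: ifP => _; last by rewrite lee_fin divr_ge0 ?mulr_ge0 ?ltW.
  by rewrite -EFinB lee_fin -mulrBl ler_pM2r ?invr_gt0//; lra.
rewrite sumEFin lee_fin sumr_const card_ord -[leLHS]mulr_natl mulrA ler_pdivrMr//.
have : q.+1%:R <= 2 * q%:R :> R by rewrite -natrM ler_nat; lia.
by move=> h; have := ler_wpM2r (ltW e0) h; lra.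
Qed.

Lemma near_set_measure_inv q j : (0 < q)%N -> (0 < j)%N ->
  (mu (near_set q (j * q)%:R^-1 `&` @circle R) <= (4 * (j%:R^-1 * q%:R^-1))%:E)%E.
Proof.
move=> q0 j0; rewrite -invfM -natrM.
apply: near_set_measure => //; first by rewrite invr_gt0 ltr0n muln_gt0 j0.
by rewrite invf_le1 ?ltr0n ?muln_gt0 ?j0// ler1n muln_gt0 j0.
Qed.

Definition close_pairs J n : seq (nat * nat) :=
  [seq (q, j) | q <- index_iota 1 n.+1, j <- index_iota 1 J.+1].

Definition pair_near_set (i : nat * nat) : set R := near_set i.1 (i.2 * i.1)%:R^-1.

Lemma measurable_pair_near_set i : measurable (pair_near_set i).
Proof. exact: measurable_near_set. Qed.

Lemma indic_near_set q e alpha : \1_(near_set q e) alpha = (near_int e (q%:R * alpha))%:R :> R.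
Proof. by rewrite indicE /near_set mem_setE. Qed.

Lemma resonance_overlap J n alpha :
  overlap R (close_pairs J n) pair_near_set alpha = (resonance alpha J n)%:R :> R.
Proof.
rewrite /overlap /close_pairs big_allpairs /resonance natr_sum.
apply: eq_bigr => q _; rewrite natr_sum; apply: eq_bigr => j _.
by rewrite indic_near_set.
Qed.

Lemma close_pairs_measure J n :
  (\sum_(i <- close_pairs J n) mu (pair_near_set i `&` @circle R)
    <= (4 * (harmonic_sum R J * harmonic_sum R n))%:E)%E.
Proof.
rewrite /close_pairs big_allpairs /harmonic_sum mulr_sumr mulr_sumr -sumEFin.
rewrite big_nat_cond [leRHS]big_nat_cond; apply: lee_sum => q; rewrite andbT => /andP[q0 _].
rewrite mulr_suml mulr_sumr -sumEFin.
rewrite big_nat_cond [leRHS]big_nat_cond; apply: lee_sum => j; rewrite andbT => /andP[j0 _].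
exact: near_set_measure_inv.
Qed.

(** The event that some [q <= n] gives an approximation too good for
    [birkhoff_le_resonance] to apply. *)
Definition hit_set (J n : nat) : set R :=
  [set alpha | 1 <= overlap R (index_iota 1 n.+1) (fun q => near_set q (J * q)%:R^-1) alpha :> R].

Definition crowded_set (J n : nat) (X : R) : set R :=
  [set alpha | X <= overlap R (close_pairs J n) pair_near_set alpha].

(** Both thresholds exceed the bounds on the respective expectations by a factor
    [c / 4], so that by Markov's inequality each of the two exceptional sets has
    measure at most [4 / c], uniformly in [k]. *)
Definition good_set (c k : nat) : set R :=
  let J := (c * k.+1)%N in
  ~` (hit_set J (2 ^ k) `|` crowded_set J (2 ^ k) (J%:R * harmonic_sum R J)).

Lemma measurable_good_set c k : measurable (good_set c k).
Proof.
apply: measurableC; apply: measurableU.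
  by apply: measurable_overlap_ge => q; exact: measurable_near_set.
by apply: measurable_overlap_ge; exact: measurable_pair_near_set.
Qed.

Lemma good_set_measure c k : (0 < c)%N ->
  (mu (@circle R `\` good_set c k) <= (8 / c%:R)%:E)%E.
Proof.
move=> c0; pose J := (c * k.+1)%N.
have J0 : (0 < J)%N by rewrite muln_gt0 c0.
have cp : 0 < c%:R :> R by rewrite ltr0n.
have kp : 0 < k.+1%:R :> R by [].
have H0 := harmonic_sum_gt0 R J0.
have hk : harmonic_sum R (2 ^ k) <= k.+1%:R := harmonic_sum_pow2_le R k.
have h0 := harmonic_sum_ge0 R (2 ^ k).
have mH : measurable (hit_set J (2 ^ k)).
  by apply: measurable_overlap_ge => q; exact: measurable_near_set.
have mC : measurable (crowded_set J (2 ^ k) (J%:R * harmonic_sum R J)).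
  by apply: measurable_overlap_ge; exact: measurable_pair_near_set.
have mc := @measurable_circle R.
rewrite setDE /good_set setCK setIUr.
apply: le_trans (measureU2 _ _ _) _; [exact: measurableI|exact: measurableI|].
have -> : 8 / c%:R = 4 / c%:R + 4 / c%:R :> R by field; rewrite lt0r_neq0.
rewrite EFinD; apply: leeD.
- apply: le_trans (@measure_overlap_ge _ _ _ mu _ (index_iota 1 (2 ^ k).+1)
    (fun q => near_set q (J * q)%:R^-1) _ mc (fun q => measurable_near_set q _)
    1 (4 * (J%:R^-1 * harmonic_sum R (2 ^ k))) ltr01 _) _; last first.
    rewrite lee_fin divr1 ler_pM2l// ler_pdivrMl ?ltr0n// /J natrM.
    by rewrite [c%:R * _]mulrC mulfK ?lt0r_neq0.
  rewrite /harmonic_sum !mulr_sumr -sumEFin.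
  rewrite big_nat_cond [leRHS]big_nat_cond; apply: lee_sum => q; rewrite andbT => /andP[q0 _].
  exact: near_set_measure_inv.
- apply: le_trans (@measure_overlap_ge _ _ _ mu _ (close_pairs J (2 ^ k))
    pair_near_set _ mc measurable_pair_near_set
    (J%:R * harmonic_sum R J) _ _ (close_pairs_measure J (2 ^ k))) _.
    by rewrite mulr_gt0// ltr0n.
  have Jn0 : J%:R != 0 :> R by rewrite pnatr_eq0 -lt0n.
  rewrite lee_fin ler_pdivrMr ?mulr_gt0 ?ltr0n//.
  have -> : 4 / c%:R * (J%:R * harmonic_sum R J) = 4 * (harmonic_sum R J * k.+1%:R).
    by rewrite /J natrM; field; rewrite lt0r_neq0.
  by rewrite ler_pM2l// ler_pM2l.
Qed.

Lemma good_set_nonres c k alpha q : good_set c k alpha -> (0 < q <= 2 ^ k)%N ->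
  ~~ near_int (c * k.+1 * q)%:R^-1 (q%:R * alpha).
Proof.
move=> /not_orP[+ _] /andP[q0 qk]; apply: contra_notN => hq.
rewrite /hit_set/= /overlap (bigD1_seq q)//= ?mem_index_iota ?q0 ?ltnS// ?iota_uniq//.
by rewrite indic_near_set hq lerDl sumr_ge0.
Qed.

Lemma good_set_resonance c k alpha : good_set c k alpha ->
  (resonance alpha (c * k.+1) (2 ^ k))%:R <=
  (c * k.+1)%:R * harmonic_sum R (c * k.+1).
Proof.
move=> /not_orP[_ /negP]; rewrite /crowded_set/= resonance_overlap.
by rewrite -ltNge => /ltW.
Qed.

Lemma good_set_birkhoff c k alpha l x : (0 < c)%N -> good_set c k alpha -> (l < 2 ^ k)%N ->
  `|birkhoff alpha l x| <= (9 * resonance alpha (c * k.+1) (2 ^ k))%N%:Z.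
Proof.
move=> c0 gk lk.
have -> : (9 * resonance alpha (c * k.+1) (2 ^ k))%N%:Z
        = 9 * (resonance alpha (c * k.+1) (2 ^ k))%:Z by rewrite PoszM.
apply: le_trans (birkhoff_le_resonance x (_ : 0 < c * k.+1)%N _) _.
- by rewrite muln_gt0 c0.
- move=> q /andP[q0 ql]; apply: good_set_nonres gk _.
  by rewrite q0 (leq_trans ql)// ltnW.
- by rewrite ler_pM2l// lez_nat leq_resonance// ltnW.
Qed.

Lemma good_set_weight c k alpha : good_set c k alpha ->
  level_weight R c k <= (2 * (9 * resonance alpha (c * k.+1) (2 ^ k)) + 1)%:R^-1.
Proof.
move=> /good_set_resonance h.
rewrite /level_weight lef_pV2 ?posrE ?ltr0n ?addn1//; last first.
  by rewrite ltr_wpDl// mulr_ge0// harmonic_sum_ge0.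
by rewrite -natr1 !natrM; lra.
Qed.

End Resonance.

(** * Sums over balanced times *)

Section BalancedSums.
Variable R : realType.
Local Notation mu := (@lebesgue_measure R).

Definition balanced_sum (alpha x : R) (D : nat) : R :=
  \sum_(1 <= n < D) n%:R^-1 * (birkhoff alpha n x == 0)%:R.

Definition bounded_set (C : R) : set (R * R) :=
  [set p | [/\ circle p.1, circle p.2 & forall D, balanced_sum p.1 p.2 D <= C]].

Lemma measurable_floor : measurable_fun setT (fun x : R => (Num.floor x)%:~R : R).
Proof.
by apply: nondecreasing_measurable => // x y xy; rewrite ler_int le_floor.
Qed.

Lemma measurable_birkhoff n :
  measurable_fun setT (fun p : R * R => (birkhoff p.1 n p.2)%:~R : R).
Proof.
have mceil : measurable_fun setT (fun x : R => (Num.ceil x)%:~R : R).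
  by apply: nondecreasing_measurable => // x y xy; rewrite ler_int le_ceil.
have -> : (fun p : R * R => (birkhoff p.1 n p.2)%:~R : R) =
  (fun p => \sum_(i < n) (1 - 2 * ((Num.ceil (p.2 + i%:R * p.1 - 2^-1))%:~R
                         - (Num.floor (p.2 + i%:R * p.1))%:~R))).
  apply/funext => p; rewrite /birkhoff rmorph_sum/=; apply: eq_bigr => i _.
  by rewrite /upper_half intrB intrM intrB.
apply: measurable_sum => i.
have mp : measurable_fun setT (fun p : R * R => p.2 + i%:R * p.1).
  apply: measurable_funD; first exact: measurable_snd.
  by apply: measurable_funM => //; exact: measurable_fst.
apply: measurable_funB => //; apply: measurable_funM => //; apply: measurable_funB.
- by apply: (measurableT_comp mceil); exact: measurable_funB.
- exact: (measurableT_comp measurable_floor).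
Qed.

Lemma measurable_balanced n : measurable [set p : R * R | birkhoff p.1 n p.2 = 0].
Proof.
have -> : [set p : R * R | birkhoff p.1 n p.2 = 0] =
    (fun p : R * R => (birkhoff p.1 n p.2)%:~R : R) @^-1` [set 0].
  apply/seteqP; split => p /= => [-> //|/eqP]; by rewrite intr_eq0 => /eqP.
by rewrite -[X in measurable X]setTI; exact: measurable_birkhoff.
Qed.

Lemma measurable_bounded_set C : measurable (bounded_set C).
Proof.
have -> : bounded_set C = (@circle R `*` @circle R) `&`
    \bigcap_D [set p | balanced_sum p.1 p.2 D <= C].
  apply/seteqP; split=> [p [h1 h2 h3]|p [[h1 h2] h3]]; first by split=> // D _ /=.
  by split=> // D; exact: h3.
apply: measurableI; first by apply: measurableX; exact: measurable_circle.
apply: bigcapT_measurable => D.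
have mf : measurable_fun setT (fun p : R * R => balanced_sum p.1 p.2 D).
  have -> : (fun p : R * R => balanced_sum p.1 p.2 D) = (fun p =>
    \sum_(1 <= n < D) n%:R^-1 * \1_[set p : R * R | birkhoff p.1 n p.2 = 0] p).
    apply/funext => p; apply: eq_bigr => n _; rewrite indicE.
    suff -> : (p \in [set p : R * R | birkhoff p.1 n p.2 = 0]) = (birkhoff p.1 n p.2 == 0) by [].
    by apply/idP/eqP => [/set_mem|h]; last exact: mem_set.
  apply: measurable_sum => n; apply: measurable_funM => //.
  by apply: measurable_indic; exact: measurable_balanced.
have -> : [set p : R * R | balanced_sum p.1 p.2 D <= C] =
    (fun p : R * R => balanced_sum p.1 p.2 D) @^-1` `]-oo, C]%classic.
  by apply/seteqP; split=> p /=; rewrite in_itv.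
by rewrite -[X in measurable X]setTI; apply: mf => //; exact: measurable_itv.
Qed.

(** Times after [n] at the level reached at time [n] are, counted from [n], the
    balanced times of the point above which the orbit is at time [n]. *)
Lemma later_returns_le alpha x C N n :
  (forall D, balanced_sum alpha (mod1 (x + n%:R * alpha)) D <= C) ->
  \sum_(m < N | (n < m)%N && (birkhoff alpha m x == birkhoff alpha n x))
    (m - n)%:R^-1 <= C.
Proof.
move=> hC; apply: le_trans (hC (N - n)%N).
rewrite -(big_mkord (fun m => (n < m)%N && (birkhoff alpha m x == birkhoff alpha n x))
  (fun m => (m - n)%:R^-1)).
have vacuous b : (b <= n.+1)%N -> \sum_(0 <= m < b |
    (n < m)%N && (birkhoff alpha m x == birkhoff alpha n x)) (m - n)%:R^-1 = 0 :> R.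
  move=> bn; rewrite big_nat_cond big_pred0// => m.
  by apply/negP => /andP[/andP[_ mb] /andP[nm _]]; move: (leq_trans mb bn); lia.
have [Nn|nN] := leqP N n.+1.
  by rewrite vacuous//; apply: sumr_ge0 => d _; rewrite mulr_ge0.
rewrite (@big_cat_nat _ _ _ n.+1)//=; last exact: ltnW.
rewrite vacuous// add0r.
rewrite -add1n big_addn /balanced_sum big_mkcond/= le_eqVlt; apply/orP; left; apply/eqP.
rewrite big_nat_cond [RHS]big_nat_cond; apply: eq_bigr => d; rewrite andbT => /andP[d0 _].
rewrite addnK birkhoff_mod1 [(d + n)%N]addnC birkhoffD.
rewrite -[X in (n < X)%N](addnC d) -{1}[n]add0n ltn_add2r d0/= -subr_eq0 addrAC subrr add0r.
by case: eqP; rewrite ?mulr1 ?mulr0.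
Qed.

(** The energy inequality along the orbit of an arbitrary [x] bounds the number
    of visits to the section; the invariance of the measure under rotation then
    turns the bound, averaged over [x], into one for the measure of the
    section. *)
Lemma bounded_section_le alpha C c K d : (0 < c)%N -> 0 <= C ->
  (d%:E <= mu (xsection (bounded_set C) alpha))%E ->
  d * \sum_(k < K) level_weight R c k * \1_(@good_set R c k) alpha <= 4 * C + 2.
Proof.
move=> c0 C0 hd; set B := xsection _ _ in hd.
have mB : measurable B by apply: measurable_xsection; exact: measurable_bounded_set.
have Bc : B `<=` @circle R by move=> x /xsectionP[].
pose L k := (9 * resonance alpha (c * k.+1) (2 ^ k))%N.
pose good k := `[< @good_set R c k alpha >].
pose s : R := \sum_(k < K | good k) (2 * L k + 1)%:R^-1.
have s0 : 0 <= s by exact: sumr_ge0.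
have ws : \sum_(k < K) level_weight R c k * \1_(@good_set R c k) alpha <= s.
  rewrite /s [leRHS]big_mkcond/=; apply: ler_sum => k _; rewrite indicE.
  rewrite /good; case: asboolP => gk; last by rewrite memNset// mulr0.
  by rewrite mem_set// mulr1; exact: good_set_weight.
pose N := (2 ^ K)%N.
have Np : 0 < N%:R :> R by rewrite ltr0n expn_gt0.
pose G (n : 'I_N) : set R := [set x | B (mod1 (x + n%:R * alpha))] `&` @circle R.
have mod1_meas (a : R) : measurable_fun setT (fun x : R => mod1 (x + a)).
  have mt : measurable_fun setT (fun x : R => x + a) by exact: measurable_funD.
  by apply: measurable_funB => //; exact: (measurableT_comp measurable_floor).
have mG n : measurable (G n).
  apply: measurableI; last exact: measurable_circle.
  by rewrite -[X in measurable X]setTI; exact: mod1_meas.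
have muG n : mu (G n) = mu B by rewrite /G setIC; exact: lebesgue_measure_rotation.
(* Dividing the energy inequality by the number of visits leaves a bound that is
   linear in it, and can be averaged over [x]. *)
have key x : circle x -> \sum_(n < N) s * \1_(G n) x <= (4 * C + 2) * N%:R.
  move=> xc; pose A := [pred n : 'I_N | x \in G n].
  have -> : \sum_(n < N) s * \1_(G n) x = #|A|%:R * s.
    rewrite -mulr_sumr mulrC; congr (_ * _).
    rewrite -sum1_card natr_sum [RHS]big_mkcond/=; apply: eq_bigr => n _.
    by rewrite indicE -[n \in A]/(x \in G n); case: (x \in G n).
  have [A0|A0] := posnP #|A|; first by rewrite A0 mul0r mulr_ge0 ?addr_ge0 ?mulr_ge0.
  have Ap : 0 < #|A|%:R :> R by rewrite ltr0n.
  rewrite -(ler_pM2l Ap) [leRHS]mulrA [leLHS]mulrA -expr2.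
  apply: (@energy_le R K (fun n => birkhoff alpha n x) A C good L).
  - move=> n xG; have [Bx _] : G n x by exact: set_mem xG.
    have [_ _ hC] : bounded_set C (alpha, mod1 (x + n%:R * alpha)) by exact/xsectionP.
    apply: le_trans (later_returns_le N hC).
    rewrite big_mkcond [leRHS]big_mkcond/=; apply: ler_sum => m _.
    by case: (m \in A) => //=; case: ifP.
  - move=> k a l /asboolP gk lk; rewrite birkhoffD addrAC subrr add0r.
    exact: good_set_birkhoff.
have M0 : 0 <= (4 * C + 2) * N%:R by rewrite mulr_ge0 ?addr_ge0 ?mulr_ge0.
have GI n : G n `&` @circle R = G n by rewrite /G -setIA setIid.
have h : (\sum_(n < N) s%:E * mu (G n `&` @circle R)
    <= ((4 * C + 2) * N%:R)%:E * mu (@circle R))%E.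
  exact: (@sum_measure_le _ _ _ mu _ (index_enum 'I_N) (fun=> s) G _ (@measurable_circle R)
    mG (fun=> s0) _ M0 key).
rewrite lebesgue_measure_circle mule1 in h.
have h2 : (\sum_(n < N) s%:E * d%:E <= ((4 * C + 2) * N%:R)%:E)%E.
  apply: le_trans h; apply: lee_sum => n _; rewrite GI muG.
  exact: lee_wpmul2l.
have : N%:R * (s * d) <= (4 * C + 2) * N%:R.
  move: h2; under eq_bigr => n _ do rewrite -EFinM.
  by rewrite sumEFin lee_fin sumr_const card_ord -[leLHS]mulr_natl.
rewrite [leRHS]mulrC ler_pM2l// mulrC => h3.
have [d0|d0] := ltP d 0.
  apply: le_trans (_ : 0 <= _); last by rewrite addr_ge0 ?mulr_ge0.
  apply: mulr_le0_ge0; first exact: ltW.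
  by apply: sumr_ge0 => k _; rewrite mulr_ge0// level_weight_ge0.
by apply: le_trans h3; rewrite ler_wpM2l.
Qed.

(** If this set had measure [a > 0], choose [c] such that for every [k] at least
    half of it lies in [good_set c k]: averaging [bounded_section_le] over it
    would bound the partial sums of the divergent series of the weights. *)
Lemma heavy_sections_null C d : 0 <= C -> 0 < d ->
  mu [set alpha | (d%:E <= mu (xsection (bounded_set C) alpha))%E] = 0%E.
Proof.
move=> C0 d0; set A := [set alpha | _].
have mA : measurable A.
  have mf := measurable_fun_xsection mu (measurable_bounded_set C).
  have -> : A = setT `&` [set x | (d%:E <= (mu \o xsection (bounded_set C)) x)%E].
    by rewrite setTI.
  exact: emeasurable_fun_c_infty.
have Ac : A `<=` @circle R.
  move=> a; rewrite /A/=; apply: contraPP => na.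
  rewrite (_ : xsection _ _ = set0) ?measure0 ?lee_fin; first by apply/negP; rewrite -ltNge.
  by apply/seteqP; split=> // x /xsectionP[].
have A1 : (mu A <= 1)%E.
  rewrite -(lebesgue_measure_circle R); apply: le_measure; rewrite ?inE//.
  exact: measurable_circle.
have Afin : mu A \is a fin_num.
  by rewrite ge0_fin_numE//; apply: le_lt_trans A1 _; exact: ltry.
have [a aE] : exists a, mu A = a%:E by exists (fine (mu A)); rewrite fineK.
rewrite aE; have a0 : 0 <= a by rewrite -lee_fin -aE.
apply/eqP; rewrite eqe eq_le a0 andbT leNgt; apply/negP => {}a0.
pose c := (Num.truncn (16 / a)).+1.
have c8 : 8 / c%:R <= a / 2.
  have := truncnS_gt (16 / a); rewrite -/c ltr_pdivrMr// => h.
  by rewrite ler_pdivrMr//; lra.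
pose M := (4 * C + 2) / d.
have M0 : 0 <= M by rewrite divr_ge0 ?addr_ge0 ?mulr_ge0// ltW.
have [K hK] := level_weight_divergent (2 * M + 1) (ltn0Sn _ : (0 < c)%N).
have half k : ((a / 2)%:E <= mu (@good_set R c k `&` A))%E.
  have mg := @measurable_good_set R c k.
  have e : (a%:E = mu (A `\` @good_set R c k) + mu (A `&` @good_set R c k))%E.
    by rewrite -aE; exact: (measureDI mu mA mg).
  have hD : (mu (A `\` @good_set R c k) <= (a / 2)%:E)%E.
    apply: le_trans (_ : (8 / c%:R)%:E <= _)%E; last by rewrite lee_fin.
    have hle : (mu (A `\` @good_set R c k) <= mu (@circle R `\` @good_set R c k))%E.
      apply: le_measure; rewrite ?inE; [exact: measurableD| |exact: setSD].
      by apply: measurableD => //; exact: measurable_circle.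
    exact: (le_trans hle (good_set_measure R k (ltn0Sn _ : (0 < c)%N))).
  rewrite setIC -(@leeD2lE _ (a / 2)%:E)// -EFinD -splitr e.
  exact: leeD2r.
have Mle : forall alpha, A alpha ->
    \sum_(k < K) level_weight R c k * \1_(@good_set R c k) alpha <= M.
  by move=> alpha Aa; rewrite /M ler_pdivlMr// mulrC; exact: bounded_section_le.
have h : (\sum_(k < K) (level_weight R c k)%:E * mu (@good_set R c k `&` A)
    <= M%:E * mu A)%E.
  exact: (@sum_measure_le _ _ _ mu _ (index_enum 'I_K) (fun k => level_weight R c k)
    (fun k => @good_set R c k) _ mA (fun k => @measurable_good_set R c k)
    (fun k => @level_weight_ge0 R c k) _ M0 Mle).
rewrite aE -EFinM in h.
have : (\sum_(k < K) (level_weight R c k * (a / 2))%:E <= (M * a)%:E)%E.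
  apply: le_trans h; apply: lee_sum => k _; rewrite EFinM; apply: lee_wpmul2l => //.
  by rewrite lee_fin level_weight_ge0.
rewrite sumEFin lee_fin -mulr_suml mulrA ler_pdivrMr// -mulrA [a * 2]mulrC mulrA ler_pM2r//.
by move: hK; lra.
Qed.

Lemma bounded_set_null C : 0 <= C -> (mu \x mu)%E (bounded_set C) = 0%E.
Proof.
move=> C0; rewrite /product_measure1.
have mf := measurable_fun_xsection mu (measurable_bounded_set C).
pose H n := [set alpha | ((n.+1%:R^-1 : R)%:E <= mu (xsection (bounded_set C) alpha))%E].
have [N [mN N0 HN]] : mu.-negligible (\bigcup_n H n).
  apply: negligible_bigcup => n; apply/negligibleP; last exact: heavy_sections_null.
  rewrite (_ : H n = setT `&` [set x | ((n.+1%:R^-1 : R)%:E <= (mu \o xsection (bounded_set C)) x)%E]).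
    exact: emeasurable_fun_c_infty.
  by rewrite setTI.
rewrite -[RHS](@integral0 _ _ _ mu setT); apply: ae_eq_integral => //.
exists N; split=> //; apply: subset_trans HN => alpha /= /not_implyP[_ /eqP hn0].
have h : (0 < mu (xsection (bounded_set C) alpha))%E by rewrite lt0e measure_ge0 andbT.
case E : (mu (xsection (bounded_set C) alpha)) h => [r| |]//; last first.
  by exists 0%N => //=; rewrite /H/= E leey.
rewrite lte_fin => r0; exists (Num.truncn r^-1) => //=.
by rewrite /H/= E lee_fin invf_ple ?posrE// ltW// truncnS_gt.
Qed.

Lemma balanced_sum_le_esum alpha x D : circle x ->
  ((balanced_sum alpha x D)%:E <=
   \esum_(n in balanced_times alpha x) ((n%:R : R)^-1)%:E)%E.
Proof.
rewrite /circle/= in_itv/= => x01.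
pose P n := (0 < n)%N && (birkhoff alpha n x == 0).
have -> : balanced_times alpha x = [set n | P n].
  apply/seteqP; split => n; rewrite /balanced_times /P /level/= iter_cylinder_flow//=.
    by move=> [-> ->]; rewrite eqxx.
  by move=> /andP[-> /eqP].
rewrite -nneseries_esum; last by move=> n _; rewrite lee_fin.
apply: le_trans (nneseries_lim_ge D _); last by move=> n _ _; rewrite lee_fin.
rewrite sumEFin lee_fin /balanced_sum; case: D => [|D]; first by rewrite big_geq// sumr_ge0.
rewrite [leRHS]big_mkcond [leRHS]big_ltn//= add0r le_eqVlt; apply/orP; left; apply/eqP.
rewrite big_nat_cond [RHS]big_nat_cond; apply: eq_bigr => n; rewrite andbT => /andP[n0 _].
by rewrite /P n0/=; case: eqP; rewrite ?mulr1 ?mulr0.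
Qed.

End BalancedSums.

Theorem theorem1 (R : realType) :
  {ae ((@lebesgue_measure R) \x (@lebesgue_measure R))%E,
    forall p : R * R,
      p.1 \in `]0, 1[ -> irrational p.1 -> circle p.2 ->
      \esum_(n in balanced_times p.1 p.2) ((n%:R : R)^-1)%:E = +oo%E}.
Proof.
have [N [mN N0 HN]] : (lebesgue_measure \x lebesgue_measure)%E.-negligible
    (\bigcup_(C : nat) bounded_set (C%:R : R)).
  apply: negligible_bigcup => C; apply/negligibleP; first exact: measurable_bounded_set.
  exact: bounded_set_null.
exists N; split=> //; apply: subset_trans HN.
move=> [alpha x] /= /not_implyP[a01 /not_implyP[_ /not_implyP[xc hfin]]].
(* The sums are unbounded outside of the exceptional sets, hence exceed every
   integer. *)
apply: contrapT => unbounded; apply: hfin; apply/eqyP => M M0.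
pose C := (Num.truncn M).+1.
apply: le_trans (_ : C%:R%:E <= _)%E; first by rewrite lee_fin ltW// truncnS_gt.
have [D hD] : exists D, C%:R < balanced_sum alpha x D.
  apply: contrapT => /forallNP nD; apply: unbounded; exists C => //; split=> //=.
    by move: a01; rewrite /circle/= !in_itv/= => /andP[/ltW-> ->].
  by move=> D; rewrite leNgt; apply/negP; exact: nD.
apply: le_trans (balanced_sum_le_esum alpha D xc); rewrite lee_fin; exact: ltW.
Qed.
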